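(* Let $(\mathcal{A},m)$ be a multiarrangement in $V=\mathbb{K}^\ell$ with a heavy hyperplane $H_0\in\mathcal{A}$. The following are equivalent: (i) $(\mathcal{A},m)$ is free. (ii) The Euler–Ziegler restriction $(\mathcal{A}^{H_0},m^{H_0})$ is free and the restriction map $\mathrm{res}^1_{H_0}:D_0(\mathcal{A},m)\to D(\mathcal{A}^{H_0},m^{H_0})$, $\delta\mapsto\delta|_{H_0}$, is surjective.
   Context: Let $\mathbb{K}$ be a field and $S=\mathbb{K}[x_1,\dots,x_\ell]$. A multiarrangement $(\mathcal{A},m)$ is a finite set of linear hyperplanes $H=\ker\alpha_H$ with $m:\mathcal{A}\to\mathbb{Z}_{>0}$, and $|m|=\sum_Hm(H)$. $D(\mathcal{A},m)=\{\theta\in\mathrm{Der}_{\mathbb{K}}(S):\theta(\alpha_H)\in\alpha_H^{m(H)}S\ \forall H\}$; freeness means this is a free $S$-module. $H_0$ is heavy if $2m(H_0)\ge|m|$. $D_0(\mathcal{A},m)=\{\delta\in D(\mathcal{A},m):\delta(\alpha_{H_0})=0\}$. For such $\delta$, $\delta|_{H_0}$ is the induced derivation of $\bar S=S/\alpha_{H_0}S$, given by $\bar f\mapsto\overline{\delta(f)}$. The Euler–Ziegler restriction is $\mathcal{A}^{H_0}=\{H_0\cap H:H\in\mathcal{A}\setminus\{H_0\}\}$, an arrangement in $H_0$, with $m^{H_0}(X)=\sum_{H\in\mathcal{A}_X\setminus\{H_0\}}m(H)$, where $\mathcal{A}_X=\{H:X\subseteq H\}$. $D(\mathcal{A}^{H_0},m^{H_0})$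 is defined analogously over $\bar S$; it is known that $\delta|_{H_0}\in D(\mathcal{A}^{H_0},m^{H_0})$. *)

(* Defs.v *)
From HB Require Import structures.
From mathcomp Require Import all_boot all_order all_algebra.
From mathcomp Require Import mpoly.
Set Implicit Arguments. Unset Strict Implicit. Unset Printing Implicit Defensive.
Import Order.TTheory GRing.Theory.
Local Open Scope ring_scope.

Section Defs.
Variable K : fieldType.

Definition mdvd (n : nat) (a f : {mpoly K[n]}) : Prop :=
  exists g : {mpoly K[n]}, f = a * g.

Definition isDer (n : nat) (d : {mpoly K[n]} -> {mpoly K[n]}) : Prop :=
  [/\ forall f g, d (f + g) = d f + d g,
      forall (c : K) f, d (c *: f) = c *: d f &
      forall f g, d (f * g) = f * d g + g * d f].

Definition lpoly (l : nat) (a : 'rV[K]_l) : {mpoly K[l]} :=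
  \sum_(k < l) a 0 k *: 'X_k.

Definition hyp (l : nat) (a : 'rV[K]_l) : 'M[K]_l := kermx a^T.

(* D(A,m) for a multiarrangement whose hyperplanes are indexed by the
   i : 'I_k with P i, with defining forms al i and multiplicities mu i. *)
Definition inD (n k : nat) (P : pred 'I_k) (al : 'I_k -> {mpoly K[n]})
  (mu : 'I_k -> nat) (d : {mpoly K[n]} -> {mpoly K[n]}) : Prop :=
  isDer d /\ forall i, P i -> mdvd (al i ^+ mu i) (d (al i)).

Definition free_mod (n : nat) (D : ({mpoly K[n]} -> {mpoly K[n]}) -> Prop) : Prop :=
  exists (r : nat) (b : 'I_r -> {mpoly K[n]} -> {mpoly K[n]}),
    [/\ forall i, D (b i),
        (forall c : 'I_r -> {mpoly K[n]},
            (forall f, \sum_(i < r) c i * b i f = 0) -> forall i, c i = 0) &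
        (forall th, D th -> exists c : 'I_r -> {mpoly K[n]},
            forall f, th f = \sum_(i < r) c i * b i f)].

(* Presentation of Sbar = S / alpha_{H0} S as K[y_1..y_{l-1}]: given a matrix
   M whose rows form a basis of H0, the quotient map is the substitution
   x_i |-> sum_j M j i * y_j  (i.e. restriction of polynomials to H0 = im M). *)
Definition resH (l : nat) (M : 'M[K]_(l.-1, l)) (f : {mpoly K[l]}) : {mpoly K[l.-1]} :=
  comp_mpoly [tuple \sum_(j < l.-1) M j i *: 'X_j | i < l] f.

Definition mEZ (l n : nat) (al : 'I_n -> 'rV[K]_l) (m : 'I_n -> nat) (i0 i : 'I_n) : nat :=
  (\sum_(j < n | (j != i0) && (hyp (al i) :&: hyp (al i0) <= hyp (al j))%MS) m j)%N.

End Defs.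

(* Main.v *)
(** Put [m_0 = m(H_0)], [alpha_0 = alpha_(H_0)] and let [Q'] be the product of the
    [alpha_H ^ m(H)] over [H <> H_0], so that heaviness reads [deg Q' <= m_0].  Induction on
    multiplicities gives, for every multiarrangement and every nonzero linear form [alpha_0],
    a derivation [e] in [D] with [e(alpha_0) = alpha_0 ^ |m|]; applied to the hyperplanes other
    than [H_0], it yields [e] in [D(A,m)] with [e(alpha_0) = alpha_0 ^ m_0], hence
    [D(A,m) = S e + D_0].  By Saito's criterion both (i) and (ii) are then equivalent to the
    existence of [l - 1] elements of [D_0] whose coefficient determinant is [Q' g] with
    [g(0) <> 0].  Expanding such a determinant into homogeneous parts produces [l - 1]
    homogeneous elements with determinant [c Q'], [c] a nonzero constant; restricted to [H_0]
    they form a basis of the restricted module, and together with [e] a basis of [D(A,m)]. *)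
Require Import Defs.
From HB Require Import structures.
From mathcomp Require Import all_boot all_order all_algebra.
From mathcomp Require Import perm mpoly.
Import Order.TTheory GRing.Theory.
Local Open Scope ring_scope.
Set Implicit Arguments. Unset Strict Implicit. Unset Printing Implicit Defensive.

Section HeavyHyperplane.
Context {K : fieldType}.

(** * Divisibility by linear forms *)

Lemma mdvd_refl n (a : {mpoly K[n]}) : mdvd a a.
Proof. by exists 1; rewrite mulr1. Qed.

Lemma mdvd0 n (a : {mpoly K[n]}) : mdvd a 0.
Proof. by exists 0; rewrite mulr0. Qed.

Lemma mdvdD n (a f g : {mpoly K[n]}) : mdvd a f -> mdvd a g -> mdvd a (f + g).
Proof. by move=> [u ->] [v ->]; exists (u + v); rewrite mulrDr. Qed.

Lemma mdvdMl n (a f g : {mpoly K[n]}) : mdvd a f -> mdvd a (g * f).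
Proof. by move=> [u ->]; exists (g * u); rewrite mulrCA. Qed.

Lemma mdvdMr n (a f g : {mpoly K[n]}) : mdvd a f -> mdvd a (f * g).
Proof. by rewrite mulrC; exact: mdvdMl. Qed.

Lemma mdvd_trans n (a b f : {mpoly K[n]}) : mdvd a b -> mdvd b f -> mdvd a f.
Proof. by move=> [u ->] [v ->]; exists (u * v); rewrite mulrA. Qed.

Lemma mdvd_sum n (I : Type) (r : seq I) (P : pred I) (F : I -> {mpoly K[n]}) a :
  (forall i, P i -> mdvd a (F i)) -> mdvd a (\sum_(i <- r | P i) F i).
Proof. by move=> aF; elim/big_rec: _ => [|i x /aF]; [exact: mdvd0 | exact: mdvdD]. Qed.

Lemma mdvd_exp2l n (a : {mpoly K[n]}) i j : (i <= j)%N -> mdvd (a ^+ i) (a ^+ j).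
Proof. by move=> /subnKC <-; exists (a ^+ (j - i)); rewrite exprD. Qed.

Lemma mpoly_morph_ind n (Pr : {mpoly K[n]} -> Prop) :
  (forall f g, Pr f -> Pr g -> Pr (f + g)) ->
  (forall c f, Pr f -> Pr (c *: f)) ->
  (forall f g, Pr f -> Pr g -> Pr (f * g)) ->
  Pr 1 -> (forall i, Pr 'X_i) -> forall f, Pr f.
Proof.
move=> PD PZ PM P1 PX; elim/mpolyind => [|c m p _ _ Pp].
  by rewrite -(scale0r 1); apply: PZ.
apply: PD => //; apply: PZ; rewrite mpolyXE_id.
elim/big_rec: _ => // i x _ Px; apply: (PM) => //.
by elim: (m i) => [|k IHk]; rewrite ?expr0 // exprS; apply: PM.
Qed.

Lemma mcoeff_lpoly l (a : 'rV[K]_l) k : (lpoly a)@_U_(k) = a 0 k.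
Proof.
rewrite /lpoly raddf_sum /= (bigD1 k) //= big1 => [|j jk].
  by rewrite addr0 mcoeffZ mcoeffXU eqxx mulr1.
by rewrite mcoeffZ mcoeffXU (negPf jk) mulr0.
Qed.

Lemma lpoly_eq0 l (a : 'rV[K]_l) : (lpoly a == 0) = (a == 0).
Proof.
apply/eqP/eqP => [a0|->]; last first.
  by rewrite /lpoly big1 // => k _; rewrite mxE scale0r.
by apply/rowP => k; rewrite -mcoeff_lpoly a0 mcoeff0 mxE.
Qed.

Lemma lpolyZ l c (a : 'rV[K]_l) : lpoly (c *: a) = c *: lpoly a.
Proof. by rewrite scaler_sumr; apply: eq_bigr => k _; rewrite mxE scalerA. Qed.

Lemma lpoly_homog l (a : 'rV[K]_l) : lpoly a \is 1.-homog.
Proof.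
by apply: rpred_sum => k _; apply: rpredZ; rewrite dhomogX /= mdeg1.
Qed.

Lemma comp_mpolyM k n (p q : {mpoly K[n]}) (g : n.-tuple {mpoly K[k]}) :
  (p * q) \mPo g = (p \mPo g) * (q \mPo g).
Proof. exact: rmorphM. Qed.

Lemma comp_mpolyXi k n i (g : n.-tuple {mpoly K[k]}) :
  'X_i \mPo g = tnth g i.
Proof. by rewrite comp_mpolyXU (tnth_nth 0). Qed.

Lemma comp_mpoly_cong l (a : {mpoly K[l]}) (g : l.-tuple {mpoly K[l]}) :
  (forall i, mdvd a ('X_i - tnth g i)) -> forall f, mdvd a (f - (f \mPo g)).
Proof.
move=> ag; elim/mpoly_morph_ind => [p q ap aq|c p ap|p q ap aq||i].
- by rewrite comp_mpolyD opprD addrACA; apply: mdvdD.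
- by rewrite comp_mpolyZ -scalerBr -mul_mpolyC; apply: mdvdMl.
- rewrite comp_mpolyM.
  have -> : p * q - (p \mPo g) * (q \mPo g)
    = p * (q - (q \mPo g)) + (p - (p \mPo g)) * (q \mPo g).
    by rewrite mulrBr mulrBl addrA subrK.
  by apply: mdvdD; [apply: mdvdMl | apply: mdvdMr].
- by rewrite comp_mpoly1 subrr; apply: mdvd0.
- by rewrite comp_mpolyXi.
Qed.

Lemma lpoly_comp k l (a : 'rV[K]_l) (B : 'M[K]_(k, l)) :
  lpoly a \mPo [tuple \sum_(j < k) B j i *: 'X_j | i < l] = lpoly (a *m B^T).
Proof.
rewrite {1}/lpoly raddf_sum /=.
under eq_bigr => i _ do rewrite comp_mpolyZ comp_mpolyXi tnth_mktuple scaler_sumr.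
rewrite exchange_big; apply: eq_bigr => j _.
rewrite mxE scaler_suml; apply: eq_bigr => i _; by rewrite scalerA mxE.
Qed.

(* [lpoly a] divides [f] iff composing [f] with a projection onto the hyperplane gives 0;
   this makes primality of linear forms a consequence of [{mpoly K[l]}] being a domain. *)
Lemma lpoly_dvd_comp l (a : 'rV[K]_l) : a != 0 ->
  exists g : l.-tuple {mpoly K[l]}, forall f, mdvd (lpoly a) f <-> f \mPo g = 0.
Proof.
case/rV0Pn => i ai.
(* A variable with nonzero coefficient absorbs the form, which sends [lpoly a] itself to 0. *)
pose g := [tuple 'X_k - (if k == i then (a 0 i)^-1 else 0) *: lpoly a | k < l].
have g0 : lpoly a \mPo g = 0.
  rewrite {1}/lpoly raddf_sum /= (eq_bigr (fun k =>
    a 0 k *: 'X_k - (if k == i then lpoly a else 0))); last first.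
    move=> k _; rewrite comp_mpolyZ comp_mpolyXi tnth_mktuple scalerBr scalerA.
    by case: eqP => [->|_]; rewrite ?mulfV ?scale1r // mulr0 scale0r.
  by rewrite sumrB -big_mkcond big_pred1_eq subrr.
exists g => f; split => [[h ->]|f0]; first by rewrite comp_mpolyM g0 mul0r.
rewrite -[f]subr0 -f0; apply: comp_mpoly_cong => k.
rewrite tnth_mktuple opprB addrC subrK -mul_mpolyC.
exact/mdvdMl/mdvd_refl.
Qed.

Lemma lpoly_prime l (a : 'rV[K]_l) f g : a != 0 ->
  mdvd (lpoly a) (f * g) -> mdvd (lpoly a) f \/ mdvd (lpoly a) g.
Proof.
case/lpoly_dvd_comp => s sP /sP; rewrite comp_mpolyM => /eqP.
by rewrite mulf_eq0 => /orP[] /eqP /sP; [left|right].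
Qed.

(** Primality moves one factor at a time over to [g], where it is cancelled before the next one. *)
Lemma lpoly_exp_dvdM l (a : 'rV[K]_l) f g k : a != 0 ->
  ~ mdvd (lpoly a) f -> mdvd (lpoly a ^+ k) (f * g) -> mdvd (lpoly a ^+ k) g.
Proof.
move=> a0 af; elim: k g => [|k IHk] g; first by exists g; rewrite mul1r.
rewrite exprS => -[h hE].
have [||[g' g'E]] := @lpoly_prime _ a f g a0 _ => //.
  by rewrite hE -mulrA; apply/mdvdMr/mdvd_refl.
rewrite g'E; have [|h' ->] := IHk g'; last by exists h'; rewrite mulrA.
exists h; apply: (@mulfI _ (lpoly a)); first by rewrite lpoly_eq0.
by rewrite mulrCA -g'E hE mulrA.
Qed.

Lemma lpoly_not_dvd1 l (a : 'rV[K]_l) : ~ mdvd (lpoly a) 1.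
Proof.
move=> [h /(congr1 (mcoeff 0))].
rewrite rmorphM /= mcoeff1 eqxx.
rewrite (_ : (lpoly a)@_0 = 0) ?mul0r => [/eqP|]; first by rewrite oner_eq0.
by apply: (dhomog_nemf_coeff (lpoly_homog a)); rewrite /= mdeg0.
Qed.

Lemma lpoly_not_dvd_exp l (a : 'rV[K]_l) f k : a != 0 ->
  ~ mdvd (lpoly a) f -> ~ mdvd (lpoly a) (f ^+ k).
Proof.
move=> a0 af; elim: k => [|k IHk]; first exact: lpoly_not_dvd1.
by rewrite exprS => /(lpoly_prime a0)[].
Qed.

Lemma lpoly_dvd l (a b : 'rV[K]_l) : mdvd (lpoly a) (lpoly b) -> (b <= a)%MS.
Proof.
(* The columns of [cokermx a] are zeros of the form of [a]; a vector whose form vanishes at all of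
   them is a multiple of [a]. *)
have ev (c : 'rV[K]_l) j : (lpoly c).@[fun k => cokermx a k j] = (c *m cokermx a) 0 j.
  rewrite mxE /lpoly raddf_sum; apply: eq_bigr => k _ /=.
  by rewrite mevalZ mevalXU.
move=> [h hE]; rewrite submxE; apply/eqP/rowP => j.
by rewrite -ev hE mevalM ev mulmx_coker mxE mul0r.
Qed.

Lemma lpoly_dvd_eqmx l (a b : 'rV[K]_l) : (b <= a)%MS -> mdvd (lpoly a) (lpoly b).
Proof.
case/sub_rVP => c ->; rewrite lpolyZ -mul_mpolyC.
exact/mdvdMl/mdvd_refl.
Qed.

Lemma rV_sub_sym l (a b : 'rV[K]_l) : b != 0 -> (b <= a)%MS -> (a <= b)%MS.
Proof.
move=> b0 /sub_rVP[c bE]; apply/sub_rVP; exists c^-1.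
have c0 : c != 0 by apply: contraNneq b0 => c0; rewrite bE c0 scale0r.
by rewrite bE scalerA mulVf ?scale1r.
Qed.

(** Powers of non-proportional forms are coprime, so factors can be divided out one by one. The
    exponent adds up proportional forms because they all use up the same prime power. *)
Lemma prod_lpoly_dvd l k (r : seq 'I_k) (a : 'I_k -> 'rV[K]_l) (m : 'I_k -> nat) D :
  (forall i, i \in r -> a i != 0) ->
  (forall i, i \in r ->
     mdvd (lpoly (a i) ^+ (\sum_(j <- r | (a j <= a i)%MS) m j)) D) ->
  mdvd (\prod_(i <- r) lpoly (a i) ^+ m i) D.
Proof.
elim: r D => [|i r IHr] D a0 aD; first by exists D; rewrite big_nil mul1r.
have ai0 : a i != 0 by apply: a0; rewrite mem_head.
have [D' DE] : mdvd (lpoly (a i) ^+ m i) D.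
  apply: mdvd_trans (aD i (mem_head _ _)); apply: mdvd_exp2l.
  by rewrite big_cons submx_refl leq_addr.
rewrite big_cons DE; suff [h ->] : mdvd (\prod_(j <- r) lpoly (a j) ^+ m j) D'.
  by exists h; rewrite mulrA.
apply: IHr => [j jr|j jr]; first by apply: a0; rewrite inE jr orbT.
have aj0 : a j != 0 by apply: a0; rewrite inE jr orbT.
have := aD j; rewrite inE jr orbT big_cons DE => /(_ isT).
have [aij|aij] := boolP (a i <= a j)%MS; last first.
  apply: lpoly_exp_dvdM => //; apply: lpoly_not_dvd_exp => // /lpoly_dvd.
  exact/negP.
have /sub_rVP[c aiE] := aij.
rewrite aiE lpolyZ exprZn exprD => -[h hE]; exists (c ^- m i *: h).
have c0 : c != 0 by apply: contraNneq ai0 => c0; rewrite aiE c0 scale0r.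
have L0 : lpoly (a j) ^+ m i != 0 by rewrite expf_neq0 ?lpoly_eq0.
apply: (mulfI L0); rewrite -!scalerAr mulrA -hE -!scalerAl scalerA.
by rewrite mulVf ?scale1r // expf_neq0.
Qed.

(** No prime factor on the right divides [g], so all of them divide out of [h]; what remains is [g]
    times a polynomial equal to 1. *)
Lemma prod_lpoly_cofactor l (I : Type) (r : seq I) (P : pred I) (a : I -> 'rV[K]_l)
    (m : I -> nat) (g h : {mpoly K[l]}) :
  (forall i, P i -> a i != 0) -> (forall i, P i -> ~ mdvd (lpoly (a i)) g) ->
  g * h = \prod_(i <- r | P i) lpoly (a i) ^+ m i -> g@_0 != 0.
Proof.
move=> a0 ag; elim: r h => [|i r IHr] h.
  rewrite big_nil => /(congr1 (mcoeff 0)); rewrite rmorphM /= mcoeff1 eqxx.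
  by apply: contra_eqN => /eqP ->; rewrite mul0r eq_sym oner_eq0.
rewrite big_cons; case: ifP => [Pi|_]; last exact: IHr.
move=> ghE; have [|h' hE] := lpoly_exp_dvdM (k := m i) (g := h) (a0 i Pi) (ag i Pi).
  by rewrite ghE; apply/mdvdMr/mdvd_refl.
apply: (IHr h'); apply: (@mulfI _ (lpoly (a i) ^+ m i)).
  by rewrite expf_neq0 ?lpoly_eq0 ?a0.
by rewrite -ghE hE mulrCA.
Qed.

(** * Homogeneous components *)

Lemma pihomogM n (Q g : {mpoly K[n]}) q d : Q \is q.-homog ->
  pihomog mdeg d (Q * g) =
  \sum_(e < msize g | (q + e == d)%N) Q * pihomog mdeg e g.
Proof.
move=> Qq; rewrite {1}[g](pihomog_partitionE (leqnn (msize g))) mulr_sumr raddf_sum /=.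
rewrite [RHS]big_mkcond; apply: eq_bigr => e _.
have QE : Q * pihomog mdeg e g \is (q + e).-homog.
  by apply: dhomogM => //; apply: pihomogP.
by case: eqP => [<-|/eqP qed]; [apply: pihomog_dE | apply: pihomog_ne0 QE].
Qed.

Lemma mdvd_pihomog n (Q f : {mpoly K[n]}) q d : Q \is q.-homog ->
  mdvd Q f -> mdvd Q (pihomog mdeg d f).
Proof.
move=> Qq [g ->]; rewrite (pihomogM _ _ Qq); apply: mdvd_sum => e _.
exact/mdvdMr/mdvd_refl.
Qed.

(** Degree [q] is the lowest that can occur in a multiple of [Q], and only the constant term of [g]
    contributes to it. *)
Lemma pihomogM_low n (Q g : {mpoly K[n]}) q : Q \is q.-homog ->
  pihomog mdeg q (Q * g) = g@_0 *: Q.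
Proof.
move=> Qq; rewrite {1}[g](pihomog_partitionE (leqnSn (msize g))) mulr_sumr raddf_sum /=.
rewrite big_ord_recl big1 ?addr0 => [|e _]; last first.
  have QE : Q * pihomog mdeg (lift ord0 e) g \is (q + lift ord0 e).-homog.
    by apply: dhomogM => //; apply: pihomogP.
  by apply: pihomog_ne0 QE; rewrite -{2}[q]addn0 eqn_add2l.
have g0 : (pihomog mdeg 0 g)@_0 = g@_0.
  rewrite [RHS](congr1 (mcoeff 0) (pihomog_partitionE (leqnSn (msize g)))).
  rewrite big_ord_recl mcoeffD [X in _ = _ + X]raddf_sum [X in _ = _ + X]big1 ?addr0 // => e _.
  by apply: dhomog_nemf_coeff (pihomogP _ _ _) _; rewrite /= mdeg0.
have -> : pihomog mdeg (@ord0 (msize g)) g = g@_0 *: 1.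
  apply/mpolyP => m; rewrite mcoeffZ mcoeff1.
  have [->|m0] := eqVneq m 0%MM; first by rewrite g0 mulr1.
  rewrite mulr0; apply: dhomog_nemf_coeff (pihomogP _ _ _) _.
  by rewrite /= mdeg_eq0.
rewrite -scalerAr mulr1 pihomog_dE //; exact: rpredZ.
Qed.

(** * Coefficient vectors and Saito's criterion *)

Local Notation cmx A := (map_mx (@mpolyC _ K) A).

(* Derivations are encoded by their coefficient vectors. The moduli [b i] and the evaluation
   vectors [a i] are kept apart: [b = a] gives the module of a multiarrangement, while
   [D_0] is obtained, after parametrizing the derivations that kill [alpha_(H_0)] by the rows of
   a matrix [M] spanning [H_0], with [b i] the form [alpha_i] and [a i] its restriction. *)
Definition logder n p k (P : pred 'I_k) (b : 'I_k -> 'rV[K]_n) (a : 'I_k -> 'rV[K]_p)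
    (mu : 'I_k -> nat) (u : 'rV[{mpoly K[n]}]_p) : Prop :=
  forall i, P i -> mdvd (lpoly (b i) ^+ mu i) ((u *m (cmx (a i))^T) 0 0).

Definition mxbasis n r p (D : 'rV[{mpoly K[n]}]_p -> Prop) (T : 'M_(r, p)) : Prop :=
  [/\ forall i, D (row i T), forall c : 'rV_r, c *m T = 0 -> c = 0 &
      forall u, D u -> exists c, u = c *m T].

(* Total multiplicity of the hyperplane of [b i]: several indices may define the same
   hyperplane, as happens after restriction to [H_0]. *)
Definition mulcl n k (P : pred 'I_k) (b : 'I_k -> 'rV[K]_n) (m : 'I_k -> nat) i : nat :=
  \sum_(j < k | P j && (b j <= b i)%MS) m j.

Section Saito.
Variables (n p k : nat) (P : pred 'I_k).
Variables (b : 'I_k -> 'rV[K]_n) (a : 'I_k -> 'rV[K]_p) (m : 'I_k -> nat).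
Hypothesis b0 : forall i, P i -> b i != 0.
Implicit Types (u v : 'rV[{mpoly K[n]}]_p).

Lemma logderD mu u v : logder P b a mu u -> logder P b a mu v -> logder P b a mu (u + v).
Proof.
by move=> Du Dv i Pi; rewrite mulmxDl mxE; apply: mdvdD; [apply: Du | apply: Dv].
Qed.

Lemma logderZ mu c u : logder P b a mu u -> logder P b a mu (c *: u).
Proof. by move=> Du i Pi; rewrite -scalemxAl mxE; apply/mdvdMl/Du. Qed.

Lemma logder0 mu : logder P b a mu 0.
Proof. by move=> i _; rewrite mul0mx mxE; apply: mdvd0. Qed.

Lemma logder_sum mu (I : Type) (r : seq I) (Q : pred I) (F : I -> 'rV_p) :
  (forall i, Q i -> logder P b a mu (F i)) -> logder P b a mu (\sum_(i <- r | Q i) F i).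
Proof. by move=> DF; elim/big_rec: _ => [|i x /DF]; [exact: logder0 | exact: logderD]. Qed.

Lemma logder_mul mu r (T : 'M_(r, p)) (c : 'rV_r) :
  (forall i, logder P b a mu (row i T)) -> logder P b a mu (c *m T).
Proof. by move=> DT; rewrite mulmx_sum_row; apply: logder_sum => i _; apply: logderZ. Qed.

(** The adjugate turns the pairings of the rows with [c] into [\det W] times [c], and some entry of
    [c] is a unit. *)
Lemma dvd_det (c : 'rV[K]_p) (g : {mpoly K[n]}) (W : 'M_p) : c != 0 ->
  (forall i, mdvd g ((row i W *m (cmx c)^T) 0 0)) -> mdvd g (\det W).
Proof.
case/rV0Pn => j cj gW.
have E : ((\adj W *m W) *m (cmx c)^T) j 0 = \det W * (c 0 j)%:MP.
  by rewrite mul_adj_mx mul_scalar_mx !mxE.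
suff gE : mdvd g (\det W * (c 0 j)%:MP).
  rewrite -[\det W]mulr1 -mpolyC1 -(mulfV cj) mpolyCM mulrA; exact: mdvdMr.
rewrite -E -mulmxA mxE; apply: mdvd_sum => i _; apply: mdvdMl.
by have := gW i; rewrite -row_mul [in X in mdvd _ X -> _]mxE.
Qed.

Let Q := \prod_(i | P i) lpoly (b i) ^+ m i.

Lemma prod_lpoly_neq0 : Q != 0.
Proof. by rewrite /Q; apply/prodf_neq0 => i Pi; rewrite expf_neq0 ?lpoly_eq0 ?b0. Qed.

Lemma prod_lpoly_dvdP (D : {mpoly K[n]}) :
  (forall i, P i -> mdvd (lpoly (b i) ^+ mulcl P b m i) D) -> mdvd Q D.
Proof.
move=> bD; rewrite /Q -big_filter; apply: prod_lpoly_dvd => i.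
  by rewrite mem_filter => /andP[/b0].
by rewrite mem_filter big_filter_cond => /andP[/bD].
Qed.

Lemma dvd_prod_lpoly (P' : pred 'I_k) i :
  (forall j, P j -> (b j <= b i)%MS -> P' j) ->
  mdvd (lpoly (b i) ^+ mulcl P b m i) (\prod_(j | P' j) lpoly (b j) ^+ m j).
Proof.
move=> PP'; rewrite /mulcl -prodrXr big_mkcond [X in mdvd _ X]big_mkcond /=.
elim/big_rec2: _ => [|j x y _ [h ->]]; first exact: mdvd_refl.
case: ifP => [/andP[Pj bj]|_]; last first.
  by rewrite mul1r; case: ifP => _; rewrite 1?mulrCA; apply/mdvdMr/mdvd_refl.
rewrite PP' //; have [g ->] := lpoly_dvd_eqmx bj.
by exists (g ^+ m j * h); rewrite exprMn mulrACA.
Qed.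

Lemma prod_dvd_det (W : 'M_p) : (forall i, P i -> a i != 0) ->
  (forall i, logder P b a (mulcl P b m) (row i W)) -> mdvd Q (\det W).
Proof.
move=> a0 DW; apply: prod_lpoly_dvdP => i Pi.
by apply: (dvd_det (a0 i Pi)) => j; apply: DW.
Qed.

(** Cramer's rule: the coefficients of [u] are quotients by [\det W] of determinants in which [u]
    replaces a row; these numerators are again multiples of [Q]. *)
Lemma saito_criterion (W : 'M_p) c : c != 0 -> (forall i, P i -> a i != 0) ->
  (forall i, logder P b a (mulcl P b m) (row i W)) -> \det W = c *: Q ->
  mxbasis (logder P b a (mulcl P b m)) W.
Proof.
move=> c0 a0 DW detW.
have cQ0 : c *: Q != 0 by rewrite scaler_eq0 negb_or c0 prod_lpoly_neq0.
split=> // [q qW0|u Du].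
  apply/rowP => j; have /rowP/(_ j) : q *m W *m \adj W = 0 by rewrite qW0 mul0mx.
  rewrite -mulmxA mul_mx_adj detW mul_mx_scalar !mxE => /eqP.
  by rewrite mulf_eq0 (negPf cQ0) => /eqP.
have Qu i : exists h, (u *m \adj W) 0 i = Q * h.
  pose W' := \matrix_r (if r == i then u else row r W).
  suff -> : (u *m \adj W) 0 i = \det W'.
    apply: (prod_dvd_det a0) => r; rewrite rowK; case: ifP => // _; exact: DW.
  rewrite (expand_det_row _ i) mxE; apply: eq_bigr => j _.
  rewrite [in RHS]mxE eqxx !mxE /cofactor; congr (_ * (_ * \det _)).
  by apply/matrixP => x y; rewrite !mxE [lift i x == i]eq_sym (negPf (neq_lift i x)) mxE.
have [h hE] := fin_all_exists Qu.
exists (\row_i (c^-1 *: h i)); apply/rowP => j; apply: (mulfI cQ0).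
transitivity ((u *m \adj W *m W) 0 j).
  by rewrite -mulmxA mul_adj_mx detW mul_mx_scalar mxE.
rewrite mxE [X in _ = _ * X]mxE mulr_sumr; apply: eq_bigr => i _.
by rewrite hE mxE mulrA -scalerAl -scalerAr scalerA mulfV // scale1r.
Qed.

(** The module contains [Q] times the standard basis, whose coordinates form [D] with
    [D *m T = Q%:M]; independence gives [T *m D = Q%:M], and ranks over the fraction field force
    [r = p]. *)
Lemma mxbasis_size r (T : 'M_(r, p)) :
  mxbasis (logder P b a (mulcl P b m)) T -> r = p.
Proof.
move=> [_ Tfree Tspan].
have DQ i : logder P b a (mulcl P b m) (Q *: delta_mx 0 i).
  move=> j Pj; rewrite -scalemxAl mxE; apply: mdvdMr.
  by apply: dvd_prod_lpoly => j' ->.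
have [C CE] := fin_all_exists (fun i => Tspan _ (DQ i)).
pose D := \matrix_i C i.
have DT : D *m T = Q%:M.
  apply/row_matrixP => i; rewrite row_mul rowK -CE.
  by apply/rowP => j; rewrite !mxE eqxx mulr_natr eq_sym.
have TD : T *m D = Q%:M.
  apply/row_matrixP => i; apply/eqP; rewrite -subr_eq0 -linearB; apply/eqP.
  apply: Tfree; rewrite -row_mul mulmxBl -mulmxA DT mul_mx_scalar mul_scalar_mx.
  by rewrite subrr row0.
have rk s t (A : 'M[{mpoly K[n]}]_(s, t)) B : A *m B = Q%:M -> (s <= t)%N.
  move=> AB; have := mulmx_max_rank (map_mx (@tofrac _) A) (map_mx (@tofrac _) B).
  rewrite -map_mxM AB map_scalar_mx mxrank_unit // unitmxE det_scalar unitfE.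
  by rewrite expf_neq0 ?tofrac_eq0 ?prod_lpoly_neq0.
by apply/eqP; rewrite eqn_leq (rk _ _ _ _ TD) (rk _ _ _ _ DT).
Qed.

Lemma det_rows_span r (D : 'rV[{mpoly K[n]}]_p -> Prop) (T : 'M_(r, p)) (A : 'M_p) :
  mxbasis D T -> (forall i, D (row i A)) -> exists C, A = C *m T.
Proof.
move=> [_ _ Tspan] DA; have [C CE] := fin_all_exists (fun i => Tspan _ (DA i)).
by exists (\matrix_i C i); apply/row_matrixP => i; rewrite row_mul rowK -CE.
Qed.

Lemma pihomog_logder mu d u :
  logder P b a mu u -> logder P b a mu (map_mx (pihomog mdeg d) u).
Proof.
move=> Du i Pi; have := mdvd_pihomog d (dhomogMn (mu i) (lpoly_homog (b i))) (Du i Pi).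
rewrite [in X in X -> _]mxE raddf_sum [in X in _ -> X]mxE.
congr mdvd; apply: eq_bigr => j _; rewrite !mxE /=.
by rewrite ![_ * _%:MP]mulrC !mul_mpolyC linearZ.
Qed.

Lemma prod_lpoly_homog : exists q, Q \is q.-homog.
Proof.
rewrite /Q; elim/big_ind: _ => [|x y [d xd] [e ye]|i _].
- by exists 0%N; apply: dhomog1.
- by exists (d + e)%N; apply: dhomogM.
- by exists (1 * m i)%N; apply/dhomogMn/lpoly_homog.
Qed.

(** Splitting each row into homogeneous components writes the determinant as a sum of terms
    [Q * h f]. The [h f] add up to [g], so one of them is nonzero at the origin. *)
Lemma homogeneous_det (W : 'M_p) g : (forall i, P i -> a i != 0) ->
  (forall i, logder P b a (mulcl P b m) (row i W)) -> \det W = Q * g -> g@_0 != 0 ->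
  exists W', (forall i, logder P b a (mulcl P b m) (row i W')) /\
    exists2 c, c != 0 & \det W' = c *: Q.
Proof.
move=> a0 DW detW g0; pose N := \max_i \max_j msize (W i j).
pose Wf (f : {ffun 'I_p -> 'I_N}) := \matrix_(i, j) pihomog mdeg (f i) (W i j).
have DWf f i : logder P b a (mulcl P b m) (row i (Wf f)).
  suff -> : row i (Wf f) = map_mx (pihomog mdeg (f i)) (row i W).
    exact/pihomog_logder/DW.
  by apply/rowP => j; rewrite !mxE.
have detWE : \det W = \sum_f \det (Wf f).
  rewrite exchange_big; apply: eq_bigr => s _ /=.
  rewrite -mulr_sumr; congr (_ * _).
  rewrite (eq_bigr (fun i => \sum_(d < N) pihomog mdeg d (W i (s i)))).
    rewrite bigA_distr_bigA; apply: eq_bigr => f _.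
    by apply: eq_bigr => i _; rewrite mxE.
  move=> i _; apply: pihomog_partitionE; rewrite /N.
  by apply: (leq_trans _ (leq_bigmax i)); apply: (leq_bigmax (s i)).
have [h hE] := fin_all_exists (fun f => prod_dvd_det a0 (DWf f)).
have [f hf0] : exists f, (h f)@_0 != 0.
  apply/existsP; apply: contraNT g0; rewrite negb_exists => /forallP h0.
  have -> : g = \sum_f h f.
    apply: (mulfI prod_lpoly_neq0); rewrite -detW detWE mulr_sumr.
    by apply: eq_bigr => f _.
  by rewrite raddf_sum big1 // => f _; apply/eqP/negbNE/h0.
exists (Wf f); split=> //; exists (h f)@_0 => //.
(* The chosen determinant is homogeneous, and its part of degree [q] is a nonzero constant times
   [Q]; hence it equals that part. *)
have [q Qq] := prod_lpoly_homog.
have Wh : \det (Wf f) \is (\sum_i f i)%N.-homog.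
  apply: rpred_sum => s _; rewrite mulr_sign.
  suff pr : \prod_i Wf f i (s i) \is (\sum_i f i)%N.-homog.
    by case: (odd_perm s); rewrite ?rpredN.
  elim/big_rec2: _ => [|i x y _ xy]; first exact: dhomog1.
  by apply: dhomogM xy; rewrite mxE; apply: pihomogP.
rewrite -(pihomogM_low _ Qq) -hE; apply/esym.
have [<-|nq] := eqVneq (\sum_i f i)%N q; first exact: pihomog_dE.
have := pihomogM_low (h f) Qq; rewrite -hE (pihomog_ne0 nq Wh) => /esym/eqP.
by rewrite scaler_eq0 (negPf hf0) (negPf prod_lpoly_neq0).
Qed.

End Saito.

(** Writing [Q] times the identity in the basis shows that [g] divides a product of the linear
    forms, so it suffices that no [a i] divides [g]. For each [i] this follows from a test matrix of
    module elements whose determinant is [Q] times a polynomial prime to [a i]. *)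
Lemma saito_converse p k (P : pred 'I_k) (a : 'I_k -> 'rV[K]_p) (m : 'I_k -> nat)
    (T : 'M[{mpoly K[p]}]_p) :
  (forall i, P i -> a i != 0) -> mxbasis (logder P a a (mulcl P a m)) T ->
  exists2 g, \det T = (\prod_(i | P i) lpoly (a i) ^+ m i) * g & g@_0 != 0.
Proof.
set Q := \prod_(i | P i) _ => a0 Tb; have [DT _ _] := Tb.
have Q0 : Q != 0 by apply: prod_lpoly_neq0.
have [g gE] : mdvd Q (\det T) by apply: prod_dvd_det DT.
exists g => //.
have LQ i : P i -> mdvd (lpoly (a i) ^+ mulcl P a m i) Q.
  by move=> Pi; apply: dvd_prod_lpoly.
have [C /(congr1 determinant)] : exists C : 'M_p, Q%:M = C *m T.
  apply: det_rows_span Tb _ => i j Pj.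
  by rewrite rowE mul_mx_scalar -scalemxAl mxE; apply/mdvdMr/LQ.
rewrite det_mulmx gE det_scalar => CE.
apply: (prod_lpoly_cofactor (r := index_enum _) (P := P) (m := fun i => (m i * p)%N)
  (h := Q * \det C) a0) => //; last first.
  rewrite mulrCA [g * _]mulrC mulrCA -CE -prodrXl.
  by apply: eq_bigr => i _; rewrite exprM.
move=> i Pi gi.
have ai0 := a0 i Pi.
(* In dimension 0 there is no nonzero form; from here on the dimension is [p.+1]. *)
case: p => [|p] in a T Q a0 Tb DT Q0 g gE LQ C CE gi ai0 *.
  by case/eqP: ai0; apply/rowP => -[].
pose R := \prod_(j | P j && ~~ (a j <= a i)%MS) lpoly (a j) ^+ m j.
have Ri : ~ mdvd (lpoly (a i)) R.
  rewrite /R; elim/big_ind: _ => [||j /andP[Pj aji]].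
  - exact: lpoly_not_dvd1.
  - by move=> x y xi yi /(lpoly_prime ai0)[].
  - by apply: lpoly_not_dvd_exp => // /lpoly_dvd; apply/negP.
(* All rows of [invmx E] except the first are vectors on which [a i] vanishes. *)
pose E := col_ebase (a i)^T.
have Eu : E \in unitmx by apply: col_ebase_unit.
have Ea x : x != 0 -> (invmx E *m (a i)^T) x 0 = 0.
  rewrite -[(a i)^T]mulmx_ebase mulmxA mulKmx // mxE big_ord1 mxE.
  rewrite -val_eqE /= => x0; rewrite andbC; case: ltnP => [xr|_]; last by rewrite mul0r.
  have := leq_trans xr (rank_leq_col _); rewrite ltnS leqn0 => /eqP xE.
  by rewrite xE in x0.
(* The transverse row gets all of [Q]; the other rows are killed by every form proportional to
   [a i], so for them [R] is enough. *)
pose A := diag_mx (\row_x (if x == 0 then Q else R)) *m cmx (invmx E).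
have rowA x : row x A = (if x == 0 then Q else R) *: cmx (row x (invmx E)).
  by apply/rowP => y; rewrite [LHS]mxE /A mul_diag_mx !mxE.
have [B /(congr1 determinant)] : exists B, A = B *m T.
  apply: det_rows_span Tb _ => x j Pj; rewrite rowA -scalemxAl mxE.
  case: eqP => [_|/eqP x0]; first exact/mdvdMr/LQ.
  have [aji|aji] := boolP (a j <= a i)%MS; last first.
    apply/mdvdMr/dvd_prod_lpoly => j' Pj' a'; rewrite Pj' /=.
    apply: contra aji => a'i; apply: submx_trans a'i.
    by apply: rV_sub_sym a'; apply: a0.
  have /sub_rVP[c ->] := aji.
  rewrite map_trmx -map_mxM -row_mul linearZ -scalemxAr 3!mxE Ea // mulr0.
  rewrite rmorph0 mulr0; exact: mdvd0.
(* After cancelling [Q], a divisor [a i] of [g] would divide a power of [R] times a unit. *)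
rewrite !det_mulmx det_diag big_ord_recl mxE eqxx gE det_map_mx.
rewrite (eq_bigr (fun=> R)) => [|x _]; last by rewrite mxE.
rewrite prodr_const mulrCA -mulrA => /(mulfI Q0) RE.
have : mdvd (lpoly (a i)) (R ^+ #|'I_p| * (\det (invmx E))%:MP).
  by rewrite RE; apply: mdvdMl.
case/(lpoly_prime ai0) => [|[h hE]]; first exact: lpoly_not_dvd_exp.
apply: (@lpoly_not_dvd1 _ (a i)); exists (h * (\det E)%:MP).
rewrite mulrA -hE -mpolyCM -det_mulmx mulVmx // det1 //.
Qed.

(** * Derivations and their coefficient vectors *)

Definition dermx l (u : 'rV[{mpoly K[l]}]_l) (f : {mpoly K[l]}) :=
  \sum_k u 0 k * f^`M(k).

Lemma dermx_isDer l (u : 'rV[{mpoly K[l]}]_l) : isDer (dermx u).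
Proof.
split=> [f g|c f|f g]; rewrite /dermx.
- by rewrite -big_split; apply: eq_bigr => k _; rewrite mderivD mulrDr.
- by rewrite scaler_sumr; apply: eq_bigr => k _; rewrite mderivZ scalerAr.
- rewrite !mulr_sumr -big_split; apply: eq_bigr => k _ /=.
  rewrite mderivM mulrDr [RHS]addrC; congr (_ + _); last by rewrite mulrCA.
  by rewrite [RHS]mulrC mulrA.
Qed.

Lemma dermxX l (u : 'rV[{mpoly K[l]}]_l) i : dermx u 'X_i = u 0 i.
Proof.
rewrite /dermx (bigD1 i) //= big1 ?addr0 => [|k ki]; rewrite mderivX mnm1E.
  rewrite eqxx scale1r (_ : (_ - _)%MM = 0%MM) ?mpolyX0 ?mulr1 //.
  by apply/mnmP => j; rewrite mnmBE mnm0E subnn.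
by rewrite eq_sym (negPf ki) scale0r mulr0.
Qed.

(** Derivations along [phi] vanish on 1, so the variables decide. Taking [phi] to be restriction
    compares a derivation with the one it induces on the hyperplane. *)
Lemma twisted_der_ext k l (phi F G : {mpoly K[l]} -> {mpoly K[k]}) : phi 1 = 1 ->
  (forall f g, F (f + g) = F f + F g) -> (forall c f, F (c *: f) = c *: F f) ->
  (forall f g, F (f * g) = phi f * F g + phi g * F f) ->
  (forall f g, G (f + g) = G f + G g) -> (forall c f, G (c *: f) = c *: G f) ->
  (forall f g, G (f * g) = phi f * G g + phi g * G f) ->
  (forall i, F 'X_i = G 'X_i) -> F =1 G.
Proof.
move=> phi1 FD FZ FM GD GZ GM FGX.
have d1 (H : {mpoly K[l]} -> {mpoly K[k]}) :
    (forall f g, H (f * g) = phi f * H g + phi g * H f) -> H 1 = 0.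
  move=> HM; have := HM 1 1; rewrite mulr1 phi1 mul1r => /eqP.
  by rewrite -subr_eq0 opprD addrA subrr sub0r oppr_eq0 => /eqP.
apply: mpoly_morph_ind => [f g Ef Eg|c f Ef|f g Ef Eg||//].
- by rewrite FD GD Ef Eg.
- by rewrite FZ GZ Ef.
- by rewrite FM GM Ef Eg.
- by rewrite !d1.
Qed.

Lemma isDerE l (d : {mpoly K[l]} -> {mpoly K[l]}) :
  isDer d -> d =1 dermx (\row_k d 'X_k).
Proof.
move=> [dD dZ dM]; have [tD tZ tM] := dermx_isDer (\row_k d 'X_k).
by apply: (@twisted_der_ext _ _ id) => // i; rewrite dermxX mxE.
Qed.

Lemma isDer_lpoly l (d : {mpoly K[l]} -> {mpoly K[l]}) (a : 'rV[K]_l) : isDer d ->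
  d (lpoly a) = (\row_k d 'X_k *m (cmx a)^T) 0 0.
Proof.
move=> [dD dZ dM]; rewrite /lpoly mxE.
have d0 : d 0 = 0 by have := dZ 0 0; rewrite !scale0r.
rewrite (big_morph d dD d0); apply: eq_bigr => k _.
by rewrite dZ !mxE -mul_mpolyC mulrC.
Qed.

Section FreeDer.
Variables (l k : nat) (P : pred 'I_k) (L : 'I_k -> {mpoly K[l]}) (b : 'I_k -> 'rV[K]_l).
Variable mu : 'I_k -> nat.
Hypothesis LE : forall i, L i = lpoly (b i).

Lemma inD_logder d : inD P L mu d -> logder P b b mu (\row_j d 'X_j).
Proof. by move=> [dd dL] i Pi; rewrite -isDer_lpoly // -LE; apply: dL. Qed.

Lemma logder_inD u : logder P b b mu u -> inD P L mu (dermx u).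
Proof.
move=> Du; split=> [|i Pi]; first exact: dermx_isDer.
rewrite LE isDer_lpoly; last exact: dermx_isDer.
by rewrite (_ : \row_j _ = u); [apply: Du | apply/rowP => j; rewrite mxE dermxX].
Qed.

Lemma free_mod_logder :
  free_mod (inD P L mu) <-> exists r (T : 'M_(r, l)), mxbasis (logder P b b mu) T.
Proof.
have dermxM r (c : 'rV_r) (T : 'M_(r, l)) f :
    \sum_(i < r) c 0 i * dermx (row i T) f = dermx (c *m T) f.
  rewrite /dermx; under eq_bigr => i _ do rewrite mulr_sumr.
  rewrite exchange_big; apply: eq_bigr => j _ /=; rewrite mxE mulr_suml.
  by apply: eq_bigr => i _; rewrite mxE mulrA.
split=> [[r [B [BD Bfree Bspan]]]|[r [T [TD Tfree Tspan]]]]; exists r.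
- pose T := \matrix_(i < r, j < l) B i 'X_j; exists T.
  have rT i : row i T = \row_j B i 'X_j by apply/rowP => j; rewrite !mxE.
  have BE i f : B i f = dermx (row i T) f by rewrite rT -isDerE //; case: (BD i).
  split=> [i|c cT|u Du]; first by rewrite rT; apply/inD_logder/BD.
    apply/rowP => i; rewrite [RHS]mxE; apply: (Bfree (fun i => c 0 i)) => f.
    under eq_bigr => j _ do rewrite BE.
    by rewrite dermxM cT /dermx big1 // => j _; rewrite mxE mul0r.
  have [c cE] := Bspan _ (logder_inD Du); exists (\row_i c i).
  apply/rowP => j; rewrite -dermxX cE -[RHS]dermxX -dermxM.
  by apply: eq_bigr => i _; rewrite BE mxE.
- exists (fun i => dermx (row i T)); split=> [i|c cT i|d Dd].
  + exact/logder_inD/TD.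
  + suff : \row_i c i = 0 by move/rowP/(_ i); rewrite !mxE.
    apply: Tfree; apply/rowP => j; rewrite -dermxX -dermxM mxE -[RHS](cT 'X_j).
    by apply: eq_bigr => i' _; rewrite mxE.
  + have [c cE] := Tspan _ (inD_logder Dd); exists (fun i => c 0 i) => f.
    by rewrite dermxM -cE -isDerE //; case: Dd.
Qed.
End FreeDer.

(** * Transversal derivations *)

Lemma lpoly_mulmx l r (c : 'rV[K]_r) (A : 'M[K]_(r, l)) :
  lpoly (c *m A) = \sum_i c 0 i *: lpoly (row i A).
Proof.
rewrite /lpoly; under [RHS]eq_bigr => i _ do rewrite scaler_sumr.
rewrite exchange_big; apply: eq_bigr => j _ /=; rewrite mxE scaler_suml.
by apply: eq_bigr => i _; rewrite mxE scalerA.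
Qed.

(* When [a0] is a combination [\sum_i c_i a_i] of forms of positive multiplicity, one may take
   [\sum_i c_i a_i e_i], with [e_i] the vector obtained after lowering the multiplicity of [a_i];
   otherwise a constant field along a common zero of these forms works. *)
Lemma exists_transversal l k (a : 'I_k -> 'rV[K]_l) (a0 : 'rV[K]_l) (m : 'I_k -> nat) :
  a0 != 0 -> exists e : 'rV[{mpoly K[l]}]_l, logder predT a a m e /\
    (e *m (cmx a0)^T) 0 0 = lpoly a0 ^+ (\sum_i m i).
Proof.
move=> nz; have [N] := ubnP (\sum_i m i)%N; elim: N m => // N IHN m mN.
(* Rows of multiplicity 0 are blanked: only forms that still impose a condition span the row
   space. *)
pose A := \matrix_i (if m i == 0%N then 0 else a i).
have [/submxP[c cE]|] := boolP (a0 <= A)%MS; last first.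
  rewrite submxE => /rV0Pn[j]; set x := (X in X != 0) => x0.
  (* A common zero of these forms, scaled so that [a0] takes the value 1 on it. *)
  pose v := x^-1 *: (col j (cokermx A))^T.
  exists (lpoly a0 ^+ (\sum_i m i) *: cmx v); split=> [i _|].
    rewrite -scalemxAl mxE map_trmx -map_mxM mxE.
    have [->|mi] := eqVneq (m i) 0%N; first by eexists; rewrite mul1r.
    suff -> : (v *m (a i)^T) 0 0 = 0 by rewrite mulr0; apply: mdvd0.
    rewrite /v -scalemxAl -trmx_mul mxE -[RHS](mulr0 x^-1); congr (_ * _).
    have := mulmx_coker A => /matrixP/(_ i j).
    rewrite [RHS]mxE => <-; rewrite [LHS]mxE !mxE.
    by apply: eq_bigr => s _; rewrite !mxE (negPf mi).
  rewrite -scalemxAl mxE map_trmx -map_mxM mxE -scalemxAl mxE -trmx_mul mxE.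
  suff -> : (a0 *m col j (cokermx A)) 0 0 = x by rewrite mulVf // mulr1.
  by rewrite /x !mxE; apply: eq_bigr => s _; rewrite mxE.
pose m' i j := (m j - (j == i))%N.
have m'E i : m i != 0%N -> (\sum_j m j = (\sum_j m' i j).+1)%N.
  move=> mi; rewrite (bigD1 i) //= [in RHS](bigD1 i) //= /m' eqxx.
  rewrite -[in LHS](@subnK 1 (m i)) ?lt0n // addnAC addn1; congr (_ + _).+1.
  by apply: eq_bigr => j /negPf ->; rewrite subn0.
have /fin_all_exists[e eE] i : exists e : 'rV[{mpoly K[l]}]_l, m i != 0%N ->
    logder predT a a (m' i) e /\
    (e *m (cmx a0)^T) 0 0 = lpoly a0 ^+ (\sum_j m' i j).
  have [mi|mi] := eqVneq (m i) 0%N; first by exists 0.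
  have [|e eE] := IHN (m' i); last by exists e.
  by rewrite -ltnS -m'E.
exists (\sum_(i | m i != 0%N) (c 0 i *: lpoly (a i)) *: e i); split=> [j _|].
  rewrite mulmx_suml summxE; apply: mdvd_sum => i mi.
  rewrite -scalemxAl mxE -scalerAl -mul_mpolyC; apply: mdvdMl.
  (* For [i = j] the extra factor [lpoly (a j)] restores the power lost in [m']; for other [i] none
     was lost. *)
  have [/(_ j isT)] := eE i mi; rewrite /m'.
  case: eqP => [->|_] [h ->] _; last by exists (lpoly (a i) * h); rewrite subn0 mulrCA.
  by exists h; rewrite mulrA -exprS /= subn1 prednK // lt0n.
have [i mi] : exists i, m i != 0%N.
  apply/existsP; apply: contraNT nz; rewrite negb_exists => /forallP m0.
  rewrite cE mulmx_sum_row big1 // => i _.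
  by rewrite rowK (negbNE (m0 i)) scaler0.
(* All the [e j] in the sum take the same value on [a0], a power with exponent one too small;
   factoring it out leaves [lpoly a0]. *)
rewrite mulmx_suml summxE (m'E i mi) exprS {2}cE lpoly_mulmx mulr_suml big_mkcond.
apply: eq_bigr => j _; rewrite rowK; have [_|mj] /= := eqVneq (m j) 0%N.
  by rewrite (_ : lpoly 0 = 0) ?scaler0 ?mul0r //; apply/eqP; rewrite lpoly_eq0.
rewrite -scalemxAl mxE; have [_ ->] := eE j mj; congr (_ * _ ^+ _).
by apply: succn_inj; rewrite -!m'E.
Qed.

(** * Linear substitutions and restriction of forms *)

Definition lin k l (B : 'M[K]_(k, l)) : l.-tuple {mpoly K[k]} :=
  [tuple \sum_(j < k) B j i *: 'X_j | i < l].

(** Linear substitutions fix the origin; this carries nonvanishing at 0 back from the hyperplane. *)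
Lemma mcoeff0_comp_lin k l (B : 'M[K]_(k, l)) f : (f \mPo lin B)@_0 = f@_0.
Proof.
move: f; apply: mpoly_morph_ind => [f g Ef Eg|c f Ef|f g Ef Eg||i].
- by rewrite comp_mpolyD !mcoeffD Ef Eg.
- by rewrite comp_mpolyZ !mcoeffZ Ef.
- by rewrite comp_mpolyM !(rmorphM (mcoeff 0)) /= Ef Eg.
- by rewrite comp_mpoly1 !mcoeff1 !eqxx.
- rewrite comp_mpolyXi tnth_mktuple raddf_sum big1 /= => [|j _].
    by rewrite mcoeffX mnm1_eq0.
  by rewrite mcoeffZ mcoeffX mnm1_eq0 mulr0.
Qed.

Lemma lpoly_col1 l (i : 'I_l) : lpoly (col i 1%:M)^T = 'X_i :> {mpoly K[l]}.
Proof.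
rewrite /lpoly (bigD1 i) //= big1 => [|j ji].
  by rewrite !mxE eqxx scale1r addr0.
by rewrite !mxE (negPf ji) scale0r.
Qed.

(** For [B = M] and [C = N], substitution along [N] becomes a section of restriction to the
    hyperplane. *)
Lemma comp_linK k l (B : 'M[K]_(k, l)) (C : 'M[K]_(l, k)) : B *m C = 1%:M ->
  forall f, (f \mPo lin C) \mPo lin B = f.
Proof.
move=> BC; apply: mpoly_morph_ind => [f g Ef Eg|c f Ef|f g Ef Eg||i].
- by rewrite !comp_mpolyD Ef Eg.
- by rewrite !comp_mpolyZ Ef.
- by rewrite !comp_mpolyM Ef Eg.
- by rewrite !comp_mpoly1.
rewrite comp_mpolyXi tnth_mktuple.
have -> : \sum_j C j i *: 'X_j = lpoly (col i C)^T.
  by apply: eq_bigr => j _; rewrite !mxE.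
by rewrite lpoly_comp -trmx_mul colE mulmxA BC -colE lpoly_col1.
Qed.

Lemma map_comp_cmx k l r s (g : l.-tuple {mpoly K[k]}) (A : 'M[K]_(r, s)) :
  map_mx (comp_mpoly g) (cmx A) = cmx A.
Proof. by apply/matrixP => i j; rewrite !mxE comp_mpolyC. Qed.

Lemma logder_mu n p k (P : pred 'I_k) (b : 'I_k -> 'rV[K]_n) (a : 'I_k -> 'rV[K]_p)
  mu mu' u : (forall i, P i -> mu i = mu' i) ->
  logder P b a mu u -> logder P b a mu' u.
Proof. by move=> E Du i Pi; rewrite -E //; apply: Du. Qed.

Lemma mxbasis_iff n r p (D D' : 'rV[{mpoly K[n]}]_p -> Prop) (T : 'M_(r, p)) :
  (forall u, D u <-> D' u) -> mxbasis D T -> mxbasis D' T.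
Proof. by move=> DD' [DT Tf Ts]; split=> // [i|u /DD'/Ts//]; apply/DD'. Qed.

Lemma mulcl_id n k (P : pred 'I_k) (b : 'I_k -> 'rV[K]_n) m i :
  (forall j, (b j <= b i)%MS -> j = i) -> P i -> mulcl P b m i = m i.
Proof.
move=> bi Pi; rewrite /mulcl (eq_bigl (pred1 i)) ?big_pred1_eq // => j /=.
by apply/andP/eqP => [[_ /bi]|->].
Qed.

(** Pairings of [w] with proportional restricted forms agree up to scalars, so they are divisible by
    the product of the corresponding powers of the unrestricted forms. Restriction merges these
    powers into one. *)
Lemma logder_restrict k l n (P : pred 'I_n) (al : 'I_n -> 'rV[K]_l) (m : 'I_n -> nat)
    (M : 'M[K]_(k, l)) (a := fun i => al i *m M^T) w :
  (forall i, P i -> al i != 0) -> (forall i, P i -> a i != 0) ->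
  logder P al a (mulcl P al m) w ->
  logder P a a (mulcl P a m) (map_mx (comp_mpoly (lin M)) w).
Proof.
move=> al0 a0 Dw i Pi.
pose P' := [pred j | P j & (a j <= a i)%MS].
have : mdvd (\prod_(j | P' j) lpoly (al j) ^+ m j) ((w *m (cmx (a i))^T) 0 0).
  apply: prod_lpoly_dvdP => [j /andP[/al0]//|j /andP[Pj aji]].
  have /sub_rVP[c ->] : (a i <= a j)%MS by apply: rV_sub_sym aji; apply: a0.
  rewrite map_mxZ linearZ /= -scalemxAr mxE; apply: mdvdMl.
  apply: mdvd_trans (Dw j Pj); apply: mdvd_exp2l.
  rewrite /mulcl big_mkcond [X in (_ <= X)%N]big_mkcond leq_sum // => j' _ /=.
  by case: (P j') => //=; case: (_ <= a i)%MS => //=; case: ifP.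
move=> [h hE]; rewrite -(map_comp_cmx (lin M) (a i)) map_trmx -map_mxM mxE hE.
rewrite rmorphM rmorph_prod /=; apply: mdvdMr.
rewrite (eq_bigr (fun j => lpoly (a j) ^+ m j)).
  by apply: dvd_prod_lpoly => j Pj aji; apply/andP.
by move=> j _; rewrite rmorphXn /= lpoly_comp.
Qed.

(** * Restriction to the heavy hyperplane *)

Section Restriction.
Variables (p n : nat) (al : 'I_n -> 'rV[K]_p.+1) (m : 'I_n -> nat) (i0 : 'I_n).
(** The rows of [v] and [M] form a basis with inverse [row_mx (al i0)^T N]: every [u] is its value
    on [al i0] times [v], plus the vector of the hyperplane with coordinates [u *m N]. *)
Variables (M : 'M[K]_(p, p.+1)) (v : 'rV[K]_p.+1) (N : 'M[K]_(p.+1, p)).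
Hypothesis al0 : forall i, al i != 0.
Hypothesis al_inj : forall i j, (al j <= al i)%MS -> j = i.
Hypothesis heavy : (\sum_(i | i != i0) m i <= m i0)%N.
Hypothesis MN : M *m N = 1%:M.
Hypothesis Mal : M *m (al i0)^T = 0.
Hypothesis split1 : (al i0)^T *m v + N *m M = 1%:M.

Let a i := al i *m M^T.
Let P : pred 'I_n := predC1 i0.
Let DA := logder predT al al m.
Let D0 := logder P al a m.
Let Q := \prod_i lpoly (al i) ^+ m i.
Let Q0 := \prod_(i | P i) lpoly (al i) ^+ m i.
Implicit Types (u : 'rV[{mpoly K[p.+1]}]_p.+1) (w : 'rV[{mpoly K[p.+1]}]_p).

Lemma restr_neq0 i : P i -> a i != 0.
Proof.
apply: contraNneq => ai0; rewrite [i](@al_inj i0 i) //.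
rewrite -[al i]trmxK -[(al i)^T]mul1mx -split1 mulmxDl -!mulmxA.
have -> : M *m (al i)^T = 0 by rewrite -[M]trmxK -trmx_mul -/(a i) ai0 trmx0.
rewrite mulmx0 addr0 trmx_mul trmxK; exact: submxMl.
Qed.

Lemma mul_restr w i : w *m (cmx (a i))^T = w *m cmx M *m (cmx (al i))^T.
Proof. by rewrite -mulmxA !map_trmx -map_mxM /a trmx_mul trmxK. Qed.

Lemma D0_extend w : D0 w -> DA (w *m cmx M).
Proof.
move=> Dw i _; have [->|ii0] := eqVneq i i0; last by rewrite -mul_restr; apply: Dw.
rewrite -mulmxA map_trmx -map_mxM Mal map_mx0 mulmx0 mxE; exact: mdvd0.
Qed.

Lemma D0_project u : DA u -> u *m (cmx (al i0))^T = 0 -> D0 (u *m cmx N).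
Proof.
move=> Du u0 i Pi; rewrite mul_restr -(mulmxA u) -map_mxM.
have -> : N *m M = 1%:M - (al i0)^T *m v by rewrite -split1 addrC addKr.
rewrite map_mxB map_mx1 map_mxM -map_trmx mulmxBr mulmx1 mulmxA u0 mul0mx subr0.
exact: Du.
Qed.

Lemma det_frame_neq0 : \det (col_mx v M : 'M_p.+1) != 0.
Proof.
have : row_mx (al i0)^T N *m col_mx v M = 1%:M by rewrite mul_row_col.
move/(congr1 determinant); rewrite det_mulmx det1 => E.
by apply: contra_eq_neq E => ->; rewrite mulr0 eq_sym oner_eq0.
Qed.

(** In the basis [v], [M] the matrix is block triangular, with diagonal blocks the value of [u] on
    [al i0] and [X]. *)
Lemma det_col_restr u (X : 'M[{mpoly K[p.+1]}]_p) :
  \det (col_mx u (X *m cmx M) : 'M_p.+1) =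
  (u *m (cmx (al i0))^T) 0 0 * \det X * (\det (col_mx v M : 'M_p.+1))%:MP.
Proof.
have -> : col_mx u (X *m cmx M) =
    block_mx (u *m (cmx (al i0))^T) (u *m cmx N) 0 X *m cmx (col_mx v M).
  rewrite map_col_mx mul_block_col mul0mx add0r; congr col_mx.
  rewrite -!mulmxA -mulmxDr map_trmx -!map_mxM -map_mxD.
  by rewrite split1 map_mx1 mulmx1.
rewrite det_mulmx; congr (_ * _); last by rewrite -det_map_mx.
by rewrite -det_mx11; apply: (@det_ublock _ 1 p).
Qed.

Lemma exists_euler : exists2 e, DA e &
  (e *m (cmx (al i0))^T) 0 0 = lpoly (al i0) ^+ m i0.
Proof.
have [e [De eE]] := exists_transversal al (fun i => if i == i0 then 0%N else m i) (al0 i0).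
have sE : (\sum_i (if i == i0 then 0 else m i))%N = (\sum_(i | i != i0) m i)%N.
  by rewrite [RHS]big_mkcond; apply: eq_bigr => i _; case: eqP.
(* With [i0] given multiplicity 0 the field reaches only the sum of the other multiplicities;
   heaviness makes the missing exponent a true difference. *)
rewrite sE in eE; exists (lpoly (al i0) ^+ (m i0 - \sum_(i | i != i0) m i) *: e).
  move=> i _; rewrite -scalemxAl mxE; have := De i isT.
  have [->|_] := eqVneq i i0; last exact: mdvdMl.
  by rewrite eE -exprD subnK // => _; apply: mdvd_refl.
by rewrite -scalemxAl mxE eE -exprD subnK.
Qed.

Lemma prod_split : Q = lpoly (al i0) ^+ m i0 * Q0.
Proof. by rewrite /Q (bigD1 i0). Qed.

Lemma D0_mulcl w : D0 w <-> logder P al a (mulcl P al m) w.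
Proof.
by split; apply: logder_mu => i Pi; rewrite mulcl_id // => j; apply: al_inj.
Qed.

Lemma DA_mulcl u : DA u <-> logder predT al al (mulcl predT al m) u.
Proof.
by split; apply: logder_mu => i Pi; rewrite mulcl_id // => j; apply: al_inj.
Qed.

(* Subtracting multiples of the transversal field [e] from a basis [T] of [DA] gives [p + 1]
   elements of [D0]; expanding [\det T] along the coefficients of [e] shows that [p] of them
   have determinant [Q0 * g] with [g] of nonzero constant term. *)
Lemma basis_restr r (T : 'M_(r, p.+1)) : mxbasis DA T ->
  exists2 W, forall i, D0 (row i W) &
    exists2 g, \det W = Q0 * g & g@_0 != 0.
Proof.
move=> /(mxbasis_iff DA_mulcl) Tb.
have rE := mxbasis_size (fun i _ => al0 i) Tb; subst r.
have [g detT g0] := saito_converse (fun i _ => al0 i) Tb.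
have {Tb}DT i : DA (row i T) by case: Tb => DT _ _; apply/DA_mulcl.
have [e De eE] := exists_euler.
have [h hE] := fin_all_exists (fun i => DT i i0 isT).
(* Dividing the values of [T] on [al i0] by that of [e] gives [f], so [T - f *m e] kills [al i0]. *)
pose f : 'cV_p.+1 := \col_i h i.
have rowTe i : row i (T - f *m e) = row i T - f i 0 *: e.
  by apply/rowP => j; rewrite !mxE big_ord1 !mxE.
have Te : (T - f *m e) *m (cmx (al i0))^T = 0.
  apply/row_matrixP => i; rewrite row_mul row0 rowTe mulmxBl -scalemxAl.
  apply/rowP => j; rewrite ord1 [LHS]mxE [X in _ + X]mxE [X in _ - X]mxE hE eE mxE.
  by rewrite mulrC subrr mxE.
pose w := (T - f *m e) *m cmx N.
have Dw i : D0 (row i w).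
  rewrite row_mul; apply: D0_project; last by rewrite -row_mul Te row0.
  rewrite rowTe -scaleNr; apply: logderD; first exact: DT.
  exact: logderZ.
have TE : T = row_mx f w *m col_mx e (cmx M).
  rewrite mul_row_col /w -mulmxA -map_mxM.
  have -> : N *m M = 1%:M - (al i0)^T *m v by rewrite -split1 addrC addKr.
  rewrite map_mxB map_mx1 map_mxM -map_trmx mulmxBr mulmx1 mulmxA Te mul0mx subr0.
  by rewrite addrC subrK.
have /fin_all_exists[d dE] i : exists d, \det (row' i w) = Q0 * d.
  apply: (prod_dvd_det (a := a)) => [j _|j|j]; [exact: al0 | exact: restr_neq0 | ].
  apply/D0_mulcl; suff -> : row j (row' i w) = row (lift i j) w by apply: Dw.
  by apply/rowP => x; rewrite !mxE.
(* Laplace expansion of [row_mx f w] along its first column, after cancelling [Q]. *)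
have gE : g = (\sum_i f i 0 * ((-1) ^+ i * d i)) * (\det (col_mx v M : 'M_p.+1))%:MP.
  apply: (mulfI (prod_lpoly_neq0 m (fun i _ => al0 i) (P := predT))).
  rewrite -detT {1}TE det_mulmx -[cmx M]mul1mx det_col_restr eE det1 mulr1.
  rewrite -[X in _ = X * _]/Q prod_split.
  suff -> : \det (row_mx f w : 'M_p.+1) = Q0 * \sum_i f i 0 * ((-1) ^+ i * d i).
    by rewrite mulrACA [Q0 * _]mulrC.
  rewrite (expand_det_col _ 0) mulr_sumr; apply: eq_bigr => i _.
  have -> : (row_mx f w : 'M_p.+1) i 0 = f i 0.
    by rewrite -[RHS](row_mxEl f w); congr (row_mx f w _ _); apply/val_inj.
  rewrite /cofactor addn0.
  have -> : col' 0 (row_mx f w : 'M_p.+1) = w.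
    apply/matrixP => x y; rewrite mxE -[RHS](row_mxEr f w).
    by congr (row_mx f w _ _); apply/val_inj.
  by rewrite dE [RHS]mulrCA; congr (_ * _); rewrite mulrCA.
have [i di0] : exists i, (d i)@_0 != 0.
  apply/existsP; apply: contraNT g0; rewrite negb_exists => /forallP d0.
  rewrite gE rmorphM raddf_sum big1 ?mul0r // => i _ /=.
  by rewrite !rmorphM /= (eqP (negbNE (d0 i))) !mulr0.
exists (row' i w) => [j|]; last by exists (d i).
suff -> : row j (row' i w) = row (lift i j) w by apply: Dw.
by apply/rowP => x; rewrite !mxE.
Qed.


Let res := comp_mpoly (lin M).
Let DE := logder P a a (mulcl P a m).

(** Once the determinant is exactly a constant times [Q0], it restricts to that constant times the
    product of restricted forms, and Saito's criterion applies on the hyperplane. *)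
Lemma restr_basis (W : 'M_p) g : (forall i, D0 (row i W)) -> \det W = Q0 * g ->
  g@_0 != 0 -> exists W' : 'M_p,
  [/\ forall i, D0 (row i W'), mxbasis DE (map_mx res W') &
      exists2 c, c != 0 & \det W' = c *: Q0].
Proof.
move=> DW detW g0.
have [W' [DW' [c c0 detW']]] := homogeneous_det (fun i _ => al0 i) restr_neq0
  (fun i => proj1 (D0_mulcl _) (DW i)) detW g0.
exists W'; split=> [i||]; [by apply/D0_mulcl | | by exists c].
apply: (saito_criterion restr_neq0 c0 restr_neq0) => [i|].
  by rewrite -map_row; apply: logder_restrict => // j; apply: restr_neq0.
rewrite det_map_mx /= detW' comp_mpolyZ rmorph_prod /=; congr (_ *: _).
by apply: eq_bigr => i _; rewrite rmorphXn /= lpoly_comp.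
Qed.

(** Adjoining the transversal field contributes the missing power of [al i0] and a nonzero constant,
    so the determinant becomes a constant multiple of [Q]. *)
Lemma extend_basis (W : 'M_p) c : (forall i, D0 (row i W)) -> c != 0 ->
  \det W = c *: Q0 -> exists T : 'M_p.+1, mxbasis DA T.
Proof.
move=> DW c0 detW; have [e De eE] := exists_euler.
exists (col_mx e (W *m cmx M)); apply: (@mxbasis_iff _ _ _ _ DA) => [u|].
  exact: iff_sym (DA_mulcl u).
pose B : 'M_p.+1 := col_mx v M.
apply: (saito_criterion (c := c * \det B) (fun i _ => al0 i)).
- by rewrite mulf_neq0 // det_frame_neq0.
- by move=> i _; apply: al0.
- move=> i; apply/DA_mulcl.
  rewrite -(@splitK 1 p i); case: (@split 1 p i) => j /=.
    have -> : row (lshift p j) (col_mx e (W *m cmx M)) = e.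
      by apply/rowP => x; rewrite mxE col_mxEu ord1.
    exact: De.
  have -> : row (rshift 1 j) (col_mx e (W *m cmx M)) = row j W *m cmx M.
    by apply/rowP => x; rewrite -row_mul [LHS]mxE [RHS]mxE col_mxEd.
  exact/D0_extend/DW.
rewrite det_col_restr eE detW -/Q prod_split -/B -scalerAr -scalerAl.
by rewrite [_ * _%:MP]mulrC mul_mpolyC scalerA.
Qed.

(** Implication from (ii) to (i): the lifts have determinant [Q0 * h], and [h] restricts to the
    cofactor [g] of the given basis, so [h] and [g] share their nonzero constant term. *)
Lemma basis_of_lifts r (U : 'M_(r, p)) : mxbasis DE U ->
  (forall eta, DE eta -> exists2 w, D0 w & map_mx res w = eta) ->
  exists T : 'M_p.+1, mxbasis DA T.
Proof.
move=> Ub lift_D; have rE := mxbasis_size restr_neq0 Ub; subst r.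
have [g detU g0] := saito_converse restr_neq0 Ub.
have [DU _ _] := Ub.
have /fin_all_exists[w wE] i : exists w, D0 w /\ map_mx res w = row i U.
  by have [w Dw wE] := lift_D _ (DU i); exists w.
pose W := \matrix_i w i.
have DW i : D0 (row i W) by rewrite rowK; case: (wE i).
have WU : map_mx res W = U.
  by apply/row_matrixP => i; rewrite -map_row rowK; case: (wE i).
have [h hE] : mdvd Q0 (\det W).
  apply: (prod_dvd_det (a := a)) => [i _|i|i]; [exact: al0 | exact: restr_neq0 | ].
  exact/D0_mulcl.
have h0 : h@_0 != 0.
  rewrite -(mcoeff0_comp_lin M) -/res (_ : res h = g) //.
  apply: (mulfI (prod_lpoly_neq0 m restr_neq0)); rewrite -detU -WU det_map_mx hE.
  rewrite rmorphM rmorph_prod /=; congr (_ * _).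
  by apply: eq_bigr => i _; rewrite rmorphXn /= lpoly_comp.
have [W' [DW' _ [c c0 detW']]] := restr_basis DW hE h0.
exact: extend_basis DW' c0 detW'.
Qed.

(** Implication from (i) to (ii): the restricted module has a basis of restrictions of elements of
    [D0], and coefficients lift by substitution along [N]. *)
Lemma restr_surj r (T : 'M_(r, p.+1)) : mxbasis DA T ->
  (exists U : 'M_p, mxbasis DE U) /\
  forall eta, DE eta -> exists2 w, D0 w & map_mx res w = eta.
Proof.
move=> /basis_restr[W DW [g detW g0]].
have [W' [DW' W'b _]] := restr_basis DW detW g0.
split=> [|eta]; first by exists (map_mx res W').
have [_ _ span /span[q qE]] := W'b.
exists (map_mx (comp_mpoly (lin N)) q *m W'); first exact: logder_mul.
rewrite map_mxM qE; congr (_ *m _); apply/rowP => i; rewrite !mxE.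
exact: comp_linK.
Qed.

Lemma mEZ_mulcl i : P i -> mEZ al m i0 i = mulcl P a m i.
Proof.
move=> Pi; apply: eq_bigl => j; congr (_ && _).
set X := (hyp (al i) :&: hyp (al i0))%MS.
have /sub_kermxP Xi : (X <= hyp (al i))%MS by apply: capmxSl.
have /sub_kermxP X0 : (X <= hyp (al i0))%MS by apply: capmxSr.
have aX k : X *m (al k)^T = X *m N *m (a k)^T.
  rewrite /a trmx_mul trmxK -!mulmxA (mulmxA N).
  have -> : N *m M = 1%:M - (al i0)^T *m v by rewrite -split1 addrC addKr.
  by rewrite mulmxBl mul1mx mulmxBr -mulmxA mulmxA X0 mul0mx subr0.
apply/sub_kermxP/idP => [Xj|/sub_rVP[c ajE]]; last first.
  by rewrite aX ajE linearZ -scalemxAr -aX Xi scaler0.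
(* The rows of [Z] are zeros of [a i] in hyperplane coordinates; [M] sends them into the
   intersection [X], where [al j] vanishes. *)
pose Z := (cokermx (a i))^T.
have ZX : (Z *m M <= X)%MS.
  rewrite sub_capmx; apply/andP; split; apply/sub_kermxP.
    by rewrite -mulmxA -[M]trmxK -trmx_mul -trmx_mul -/(a i) mulmx_coker trmx0.
  by rewrite -mulmxA Mal mulmx0.
have : Z *m M *m (al j)^T = 0 by apply/sub_kermxP/(submx_trans ZX)/sub_kermxP.
rewrite -mulmxA -[M]trmxK -trmx_mul -trmx_mul -/(a j) => /(congr1 trmx).
by rewrite trmxK trmx0 submxE => ->.
Qed.

End Restriction.

(** * Adapted coordinates and the equivalence *)

Lemma hyp_sub l (a b : 'rV[K]_l) : (b <= a)%MS -> (hyp a <= hyp b)%MS.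
Proof.
case/sub_rVP => c ->; apply/sub_kermxP.
by rewrite linearZ -scalemxAr mulmx_ker scaler0.
Qed.

Lemma split_hyperplane p (a : 'rV[K]_p.+1) (M : 'M[K]_(p, p.+1)) :
  a != 0 -> M *m a^T = 0 -> \rank M = p ->
  exists v N, M *m N = 1%:M /\ a^T *m v + N *m M = 1%:M.
Proof.
case/rV0Pn => i ai Ma rM.
have /row_freeP[N' MN'] : row_free M by rewrite /row_free rM.
pose v : 'rV_p.+1 := (a 0 i)^-1 *: delta_mx 0 i.
have va : v *m a^T = 1%:M.
  rewrite -scalemxAl -rowE; apply/rowP => j; rewrite ord1 !mxE mulVf //.
(* The correction makes [v] times the new matrix vanish and, as [M *m a^T = 0], keeps it a right
   inverse of [M]; a one-sided inverse of a square matrix is two-sided. *)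
exists v, (N' - a^T *m (v *m N')).
have MN : M *m (N' - a^T *m (v *m N')) = 1%:M.
  by rewrite mulmxBr mulmxA Ma mul0mx subr0.
split=> //; rewrite -mul_row_col.
suff : col_mx v M *m row_mx a^T (N' - a^T *m (v *m N')) = 1%:M by apply: mulmx1C.
rewrite mul_col_row va Ma MN mulmxBr mulmxA va mul1mx subrr.
by rewrite -scalar_mx_block.
Qed.
End HeavyHyperplane.

Theorem theorem3p10 (K : fieldType) (l n : nat) (al : 'I_n -> 'rV[K]_l)
  (m : 'I_n -> nat) (i0 : 'I_n) (M : 'M[K]_(l.-1, l)) :
  (forall i, al i != 0) ->
  (forall i j, i != j -> ~~ (hyp (al i) == hyp (al j))%MS) ->
  (forall i, (0 < m i)%N) ->
  (\sum_(i < n) m i <= 2 * m i0)%N ->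
  (M <= hyp (al i0))%MS -> \rank M = l.-1 ->
  free_mod (fun d => inD predT (fun i => lpoly (al i)) m d)
  <->
  (free_mod (fun eta => inD (predC1 i0) (fun i => resH M (lpoly (al i)))
                            (mEZ al m i0) eta)
   /\
   forall eta, inD (predC1 i0) (fun i => resH M (lpoly (al i))) (mEZ al m i0) eta ->
     exists d, [/\ inD predT (fun i => lpoly (al i)) m d,
                   d (lpoly (al i0)) = 0 &
                   forall f, eta (resH M f) = resH M (d f)]).
Proof.
move=> al0 al_hyp _ heavy2 /sub_kermxP Mal rM.
case: l => [|p] in al M al0 al_hyp Mal rM *.
  by have /rV0Pn[[]] := al0 i0.
rewrite /= in M Mal rM *.
have [v [N [MN split1]]] := split_hyperplane (al0 i0) Mal rM.
have al_inj i j : (al j <= al i)%MS -> j = i.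
  move=> ji; apply/eqP; apply: contraTT isT => /al_hyp.
  by rewrite !hyp_sub //; apply: rV_sub_sym.
have heavy : (\sum_(i | i != i0) m i <= m i0)%N.
  by move: heavy2; rewrite (bigD1 i0) //= mul2n -addnn leq_add2l.
pose a i := al i *m M^T.
have LA i : lpoly (al i) = lpoly (al i) by [].
have LE i : @resH K p.+1 M (lpoly (al i)) = lpoly (a i) by apply: lpoly_comp.
have DE_EZ w : logder (predC1 i0) a a (mulcl (predC1 i0) a m) w <->
    logder (predC1 i0) a a (mEZ al m i0) w.
  by split; apply: logder_mu => i Pi; rewrite (mEZ_mulcl _ Mal split1).
(* Surjectivity in coordinates: derivations killing [al i0] have coefficient vectors [w *m M], and
   restriction acts on the entries of [w]. *)
have surjP : (forall w, logder (predC1 i0) a a (mulcl (predC1 i0) a m) w ->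
      exists2 w', logder (predC1 i0) al a m w' & map_mx (comp_mpoly (lin M)) w' = w) <->
    (forall eta, inD (predC1 i0) (fun i => @resH K p.+1 M (lpoly (al i))) (mEZ al m i0) eta ->
     exists d, [/\ inD predT (fun i => lpoly (al i)) m d,
                   d (lpoly (al i0)) = 0 &
                   forall f, eta (@resH K p.+1 M f) = @resH K p.+1 M (d f)]).
  split=> [surj eta Deta|surj w /DE_EZ Dw].
    have [w Dw wE] := surj _ (proj2 (DE_EZ _) (inD_logder LE Deta)).
    exists (dermx (w *m map_mx (@mpolyC _ K) M)); split.
    - by apply: (logder_inD LA); apply: (D0_extend Mal Dw).
    - rewrite isDer_lpoly; last exact: dermx_isDer.
      rewrite (_ : \row_j _ = w *m map_mx (@mpolyC _ K) M); last first.
        by apply/rowP => j; rewrite mxE dermxX.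
      by rewrite -mulmxA map_trmx -map_mxM Mal map_mx0 mulmx0 mxE.
    have [[eD eZ eM] _] := Deta.
    have [dD dZ dM] := dermx_isDer (w *m map_mx (@mpolyC _ K) M).
    apply: (@twisted_der_ext K _ _ (@resH K p.+1 M)); rewrite /resH.
    - exact: comp_mpoly1.
    - by move=> f g; rewrite comp_mpolyD eD.
    - by move=> c f; rewrite comp_mpolyZ eZ.
    - by move=> f g; rewrite comp_mpolyM eM.
    - by move=> f g; rewrite dD comp_mpolyD.
    - by move=> c f; rewrite dZ comp_mpolyZ.
    - by move=> f g; rewrite dM comp_mpolyD !comp_mpolyM.
    move=> i; rewrite dermxX comp_mpolyXi tnth_mktuple mxE raddf_sum /=.
    have e0 : eta 0 = 0 by have := eZ 0 0; rewrite !scale0r.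
    rewrite (big_morph eta eD e0); apply: eq_bigr => j _.
    have /rowP/(_ j) := wE; rewrite !mxE => wj.
    by rewrite eZ comp_mpolyM -/(lin M) comp_mpolyC -wj mulrC mul_mpolyC.
  have [d [Dd d0 dE]] := surj _ (logder_inD LE Dw).
  have [dd _] := Dd.
  exists ((\row_j d 'X_j) *m map_mx (@mpolyC _ K) N).
    apply: (D0_project split1); first exact: (inD_logder LA).
    by apply/rowP => j; rewrite ord1 -isDer_lpoly // d0 mxE.
  apply/rowP => j; rewrite mxE.
  (* Since [M *m N = 1%:M], this form restricts to the variable of index [j], and testing on it
     reads off entry [j]. *)
  have := dE (lpoly (col j N)^T).
  rewrite isDer_lpoly // /resH lpoly_comp -trmx_mul {1}colE mulmxA MN -(colE j 1%:M).
  rewrite -/(lin M) lpoly_col1.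
  rewrite dermxX => ->; congr (_ \mPo _); rewrite !mxE.
  by apply: eq_bigr => k _; rewrite !mxE.
have freeA := free_mod_logder predT m LA.
have freeE := free_mod_logder (predC1 i0) (mEZ al m i0) LE.
split=> [/freeA[r [T Tb]]|[/freeE[r [U Ub]] /surjP surj]].
  have [[U Ub] surj] := restr_surj al0 al_inj heavy MN split1 Tb.
  split; last exact/surjP.
  by apply/freeE; exists p, U; apply: mxbasis_iff Ub.
apply/freeA; exists p.+1.
apply: (basis_of_lifts al0 al_inj heavy Mal split1 _ surj).
by apply: mxbasis_iff Ub => w; apply: iff_sym.
Qed.
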